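(* Let $T_1,T_2$ be theories in disjoint languages and $T_1\sqcup T_2$ their disjoint union. (1) Both $T_1$ and $T_2$ are almost $n$-ary if and only if $T_1\sqcup T_2$ is almost $n$-ary; moreover, ${\rm aar}(T_1\sqcup T_2)=\max\{{\rm aar}(T_1),{\rm aar}(T_2)\}$. (2) Both $T_1$ and $T_2$ are almost $n$-aritizable if and only if $T_1\sqcup T_2$ is almost $n$-aritizable.
   Context: For theories $T_1,T_2$ in disjoint relational languages $\Sigma_1,\Sigma_2$ with models $\mathcal{M}_1\models T_1$, $\mathcal{M}_2\models T_2$ on disjoint universes, the disjoint union $\mathcal{M}_1\sqcup\mathcal{M}_2$ is the structure in the language $\Sigma_1\cup\Sigma_2\cup\{P_1,P_2\}$ ($P_i$ new unary predicates) with universe $M_1\cup M_2$, $P_i$ interpreted as $M_i$, and the symbols of $\Sigma_i$ interpreted as in $\mathcal{M}_i$; $T_1\sqcup T_2={\rm Th}(\mathcal{M}_1\sqcup\mathcal{M}_2)$. For $n\geq 1$, a formula $\varphi(\overline{x})$ of a theory $T$ is $n$-ary (an $n$-formula) if it is $T$-equivalent to a Boolean combination of $T$-formulas each of which has $n$ free variables. $T$ is almost $n$-ary if there are finitely many formulas $\varphi_1(\overline{x}),\ldots,\varphi_m(\overline{x})$ such that every $T$-formula is $T$-equivalent to a Boolean combination of $n$-formulas and of formulas obtained from $\varphi_1(\overline{x}),\ldots,\varphi_m(\overline{x})$ by substitutions of free variables. ${\rm aar}(T)$ is the least $n$ such that $T$ is almost $n$-ary ($\infty$ if there is none). $T$ is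 almost $n$-aritizable if some expansion of $T$ (a theory in a larger language whose restriction to the language of $T$ is $T$) is almost $n$-ary. *)

(* Defs.v *)
From mathcomp Require Import all_boot.
From mathcomp Require Import boolp.

Set Implicit Arguments.
Unset Strict Implicit.
Unset Printing Implicit Defensive.

Record language := Language {
  fsym : Type;
  farity : fsym -> nat;
  rsym : Type;
  rarity : rsym -> nat }.

Record rel_language := RelLanguage {
  psym : Type;
  parity : psym -> nat }.

Definition lang_of_rel (L : rel_language) : language :=
  @Language void (fun f => match f with end) (psym L) (@parity L).
Coercion lang_of_rel : rel_language >-> language.

(* Variables are de Bruijn indices: [Ex phi] binds index 0 of [phi], and the
   index [i.+1] of [phi] is the variable [i] of [Ex phi]. *)
Inductive term (L : language) : Type :=
| Var of nat
| App (f : fsym L) of ('I_(farity f) -> term L).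
Arguments Var {L}.

Inductive formula (L : language) : Type :=
| Eq of term L & term L
| Rel (r : rsym L) of ('I_(rarity r) -> term L)
| Not of formula L
| And of formula L & formula L
| Ex of formula L.

Fixpoint tvars L (t : term L) : seq nat :=
  match t with
  | Var i => [:: i]
  | App f ts => flatten [seq tvars (ts i) | i <- enum 'I_(farity f)]
  end.

Fixpoint fvars L (phi : formula L) : seq nat :=
  match phi with
  | Eq t u => tvars t ++ tvars u
  | Rel r ts => flatten [seq tvars (ts i) | i <- enum 'I_(rarity r)]
  | Not p => fvars p
  | And p q => fvars p ++ fvars q
  | Ex p => [seq i.-1 | i <- fvars p & i != 0]
  end.

Definition num_fvars L (phi : formula L) : nat := size (undup (fvars phi)).

Definition sentence L (phi : formula L) : bool := nilp (fvars phi).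

Fixpoint trename L (s : nat -> nat) (t : term L) : term L :=
  match t with
  | Var i => Var (s i)
  | App f ts => App (fun i => trename s (ts i))
  end.

Definition up (s : nat -> nat) (i : nat) : nat :=
  if i is j.+1 then (s j).+1 else 0.

(* Capture-free substitution of the variable [s i] for each free variable
   [i]; [s] need not be injective. *)
Fixpoint rename L (s : nat -> nat) (phi : formula L) : formula L :=
  match phi with
  | Eq t u => Eq (trename s t) (trename s u)
  | Rel r ts => Rel (fun i => trename s (ts i))
  | Not p => Not (rename s p)
  | And p q => And (rename s p) (rename s q)
  | Ex p => Ex (rename (up s) p)
  end.

Record structure (L : language) := Structure {
  dom :> Type;
  dom_inh : inhabited dom;
  fint : forall f : fsym L, ('I_(farity f) -> dom) -> dom;
  rint : forall r : rsym L, ('I_(rarity r) -> dom) -> Prop }.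

Fixpoint teval L (M : structure L) (e : nat -> M) (t : term L) : M :=
  match t with
  | Var i => e i
  | App f ts => fint (fun i => teval e (ts i))
  end.

Definition scons (A : Type) (a : A) (e : nat -> A) (i : nat) : A :=
  if i is j.+1 then e j else a.

Fixpoint sat L (M : structure L) (e : nat -> M) (phi : formula L) : Prop :=
  match phi with
  | Eq t u => teval e t = teval e u
  | Rel r ts => rint (fun i => teval e (ts i))
  | Not p => ~ sat e p
  | And p q => sat e p /\ sat e q
  | Ex p => exists a : M, sat (scons a e) p
  end.

Definition truein L (M : structure L) (phi : formula L) : Prop :=
  forall e : nat -> M, sat e phi.

(* Complete theories, as maximal satisfiable sets of sentences.  Such a set
   is closed under consequence. *)
Record theory (L : language) := Theory {
  thm :> formula L -> Prop;
  thm_sentence : forall phi, thm phi -> sentence phi;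
  thm_satisfiable : exists M : structure L, forall phi, thm phi -> truein M phi;
  thm_complete : forall phi, sentence phi -> thm phi \/ thm (Not phi) }.

Definition is_model L (M : structure L) (T : theory L) : Prop :=
  forall phi, T phi -> truein M phi.

Lemma eq_teval L (M : structure L) (e1 e2 : nat -> M) (t : term L) :
  {in tvars t, e1 =1 e2} -> teval e1 t = teval e2 t.
Proof.
elim: t => [i|f ts IH] /= h; first by apply: h; rewrite inE.
congr fint; apply/funext => i; apply: IH => j hj; apply: h.
by apply/flatten_mapP; exists i; rewrite ?mem_enum.
Qed.

Lemma eq_sat L (M : structure L) (phi : formula L) (e1 e2 : nat -> M) :
  {in fvars phi, e1 =1 e2} -> sat e1 phi <-> sat e2 phi.
Proof.
elim: phi e1 e2 => [t u|r ts|p IH|p IHp q IHq|p IH] e1 e2 /= h.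
- by rewrite (@eq_teval _ _ e1 e2 t) 1?(@eq_teval _ _ e1 e2 u) // => i hi;
    apply: h; rewrite mem_cat hi ?orbT.
- suff -> : (fun i => teval e1 (ts i)) = (fun i => teval e2 (ts i)) by [].
  apply/funext => i; apply: eq_teval => j hj; apply: h.
  by apply/flatten_mapP; exists i; rewrite ?mem_enum.
- by have [h1 h2] := IH _ _ h; split=> hn hp; apply: hn; auto.
- have [a b] : sat e1 p <-> sat e2 p.
    by apply: IHp => i hi; apply: h; rewrite mem_cat hi.
  have [c d] : sat e1 q <-> sat e2 q.
    by apply: IHq => i hi; apply: h; rewrite mem_cat hi orbT.
  by split=> -[? ?]; split; auto.
- have H a : sat (scons a e1) p <-> sat (scons a e2) p.
    apply: IH => -[|i] hi //=; apply: h.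
    by apply/mapP; exists i.+1; rewrite // mem_filter.
  by split=> -[a ha]; exists a; apply/H.
Qed.

Definition true_sentence L (M : structure L) (phi : formula L) : Prop :=
  sentence phi /\ truein M phi.

Lemma true_sentence_sentence L (M : structure L) (phi : formula L) :
  true_sentence M phi -> sentence phi.
Proof. by case. Qed.

Lemma true_sentence_satisfiable L (M : structure L) :
  exists N : structure L, forall phi, true_sentence M phi -> truein N phi.
Proof. by exists M => phi []. Qed.

Lemma true_sentence_complete L (M : structure L) (phi : formula L) :
  sentence phi -> true_sentence M phi \/ true_sentence M (Not phi).
Proof.
move=> sphi; have [a] := dom_inh M.
have ind (e1 e2 : nat -> M) : sat e1 phi -> sat e2 phi.
  by apply: (eq_sat (e1 := e1) _).1; rewrite (nilP sphi).
have [h|h] := pselect (sat (fun=> a) phi); [left|right]; split=> // e.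
  exact: ind h.
by move=> he; apply: h; apply: ind he.
Qed.

Definition Th L (M : structure L) : theory L :=
  Theory (@true_sentence_sentence L M) (true_sentence_satisfiable M)
    (@true_sentence_complete L M).

Definition equivalent L (T : theory L) (phi psi : formula L) : Prop :=
  forall M : structure L, is_model M T ->
  forall e : nat -> M, sat e phi <-> sat e psi.

Inductive bool_comb L (D : formula L -> Prop) : formula L -> Prop :=
| bc_base phi : D phi -> bool_comb D phi
| bc_not phi : bool_comb D phi -> bool_comb D (Not phi)
| bc_and phi psi :
    bool_comb D phi -> bool_comb D psi -> bool_comb D (And phi psi).

(* "Having n free variables" is understood as for a formula written
   phi(x_1, ..., x_n): the free variables are among n given ones. *)
Definition nary_formula L (T : theory L) (n : nat) (phi : formula L) : Prop :=
  exists2 psi, bool_comb (fun chi => num_fvars chi <= n) psi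
             & equivalent T phi psi.

Definition almost_nary L (T : theory L) (n : nat) : Prop :=
  exists (m : nat) (phis : 'I_m -> formula L),
  forall phi : formula L,
  exists2 psi,
    bool_comb (fun chi => nary_formula T n chi \/
                 exists (i : 'I_m) (s : nat -> nat), chi = rename s (phis i)) psi
  & equivalent T phi psi.

(* [None] stands for infinity. *)
Definition aar L (T : theory L) : option nat :=
  match pselect (exists n, (0 < n) && `[< almost_nary T n >]) with
  | left h => Some (ex_minn h)
  | right _ => None
  end.

Definition max_infty (a b : option nat) : option nat :=
  if a is Some m then if b is Some n then Some (maxn m n) else None else None.

(* The general form, up to renaming symbols, of a language containing [L]:
   [E] consists of the new symbols. *)
Definition lang_sum (L E : language) : language :=
  @Language (fsym L + fsym E)
    (fun f => match f with inl g => farity g | inr g => farity g end)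
    (rsym L + rsym E)
    (fun r => match r with inl q => rarity q | inr q => rarity q end).

Fixpoint tlift L E (t : term L) : term (lang_sum L E) :=
  match t with
  | Var i => Var i
  | App f ts => @App (lang_sum L E) (inl f) (fun i => tlift E (ts i))
  end.

Fixpoint lift L E (phi : formula L) : formula (lang_sum L E) :=
  match phi with
  | Eq t u => Eq (tlift E t) (tlift E u)
  | Rel r ts => @Rel (lang_sum L E) (inl r) (fun i => tlift E (ts i))
  | Not p => Not (lift E p)
  | And p q => And (lift E p) (lift E q)
  | Ex p => Ex (lift E p)
  end.

Definition is_expansion L E (T : theory L) (T' : theory (lang_sum L E)) : Prop :=
  forall phi : formula L, T' (lift E phi) <-> T phi.

Definition almost_naritizable L (T : theory L) (n : nat) : Prop :=
  exists (E : language) (T' : theory (lang_sum L E)),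
    is_expansion T T' /\ almost_nary T' n.

(* [inr false] and [inr true] are the predicates P_1 and P_2. *)
Definition dunion_language (L1 L2 : rel_language) : rel_language :=
  @RelLanguage (psym L1 + psym L2 + bool)
    (fun r => match r with
              | inl (inl q) => parity q
              | inl (inr q) => parity q
              | inr _ => 1
              end).

Definition dunion_rint (L1 L2 : rel_language)
    (M1 : structure L1) (M2 : structure L2)
    (r : rsym (dunion_language L1 L2)) :
    ('I_(rarity r) -> M1 + M2) -> Prop :=
  match r return ('I_(@rarity (dunion_language L1 L2) r) -> M1 + M2) -> Prop with
  | inl (inl q) => fun xs =>
      exists2 v, xs = (fun i => inl (v i)) & @rint L1 M1 q v
  | inl (inr q) => fun xs =>
      exists2 v, xs = (fun i => inr (v i)) & @rint L2 M2 q v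
  | inr false => fun xs => exists a, xs ord0 = inl a
  | inr true => fun xs => exists b, xs ord0 = inr b
  end.

Lemma dunion_inh (L1 L2 : rel_language)
    (M1 : structure L1) (M2 : structure L2) : inhabited (M1 + M2).
Proof. by have [a] := dom_inh M1; exists; left. Qed.

Definition dunion (L1 L2 : rel_language)
    (M1 : structure L1) (M2 : structure L2) :
    structure (dunion_language L1 L2) :=
  @Structure (dunion_language L1 L2) (M1 + M2)%type (dunion_inh M1 M2)
    (fun f => match f with end) (@dunion_rint L1 L2 M1 M2).

(* Main.v *)
Require Import Defs.
From mathcomp Require Import all_boot.
From mathcomp Require Import boolp.

Set Implicit Arguments.
Unset Strict Implicit.
Unset Printing Implicit Defensive.

(* Since the theories are complete, equivalence of formulas can be tested in any
   one model, so almost n-arity is a property of the family of definable sets of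
   assignments [nat -> M].  By the Feferman-Vaught argument, once it is known
   which variables lie in which part, a formula over the disjoint union is a
   finite disjunction of conjunctions of a formula over the first part and a
   formula over the second, chosen uniformly in the models.  Hence definable sets
   of the union trace definable sets on each part, and conversely they are
   Boolean combinations of the unary conditions "x_i lies in part 1" and of
   relativized formulas of the parts.  For expansions, one passes to models of
   the expanded theories and expands by all sets of a suitable family: the traces
   on a part of the union, or the definable sets of a union of Morleyized parts.
   This also removes the function symbols that an expansion may contain. *)

(** * Renaming, closure and elementary equivalence *)

Lemma teval_trename L (M : structure L) (e : nat -> M) s t :
  teval e (trename s t) = teval (e \o s) t.
Proof.
elim: t => [i|f ts IH] //=; congr fint; apply/funext => i; exact: IH.
Qed.

Lemma scons_up (A : Type) (a : A) (e : nat -> A) s :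
  scons a e \o up s = scons a (e \o s).
Proof. by apply/funext => -[]. Qed.

Lemma sat_rename L (M : structure L) phi (e : nat -> M) s :
  sat e (rename s phi) <-> sat (e \o s) phi.
Proof.
elim: phi e s => [t u|r ts|p IH|p IHp q IHq|p IH] e s /=.
- by rewrite !teval_trename.
- rewrite (_ : (fun i => teval e _) = (fun i => teval (e \o s) (ts i))) //.
  by apply/funext => i; rewrite teval_trename.
- by rewrite IH.
- by rewrite IHp IHq.
- by split=> -[a]; rewrite ?IH ?scons_up => ha; exists a; rewrite ?IH ?scons_up.
Qed.

Lemma tvars_trename L s (t : term L) : tvars (trename s t) = map s (tvars t).
Proof.
elim: t => [i|f ts IH] //=.
rewrite map_flatten -map_comp; congr flatten; apply: eq_map => i; exact: IH.
Qed.

Lemma mem_fvars_rename L s (phi : formula L) j :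
  j \in fvars (rename s phi) -> exists2 i, i \in fvars phi & j = s i.
Proof.
elim: phi s j => [t u|r ts|p IH|p IHp q IHq|p IH] s j /=.
- rewrite !tvars_trename -map_cat => /mapP [i hi ->]; by exists i.
- case/flatten_mapP => i hi; rewrite tvars_trename => /mapP [k hk ->].
  by exists k => //; apply/flatten_mapP; exists i.
- exact: IH.
- by rewrite mem_cat => /orP [/IHp|/IHq] [i hi ->]; exists i; rewrite // mem_cat hi ?orbT.
- case/mapP => k; rewrite mem_filter => /andP [k0 /IH [i hi hk]] ->.
  case: i hi hk => [|i] hi hk; first by rewrite hk in k0.
  exists i; last by rewrite hk.
  by apply/mapP; exists i.+1; rewrite // mem_filter.
Qed.

Lemma fvars_bound L (phi : formula L) : exists k, {subset fvars phi <= iota 0 k}.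
Proof.
exists (\max_(i <- fvars phi) i).+1 => i hi.
by rewrite mem_iota add0n /= ltnS (big_rem i) //= leq_maxl.
Qed.

Lemma fvars_iter_Ex L (phi : formula L) k i :
  i \in fvars (iter k (@Ex L) phi) -> i + k \in fvars phi.
Proof.
elim: k i => [|k IH] i /=; first by rewrite addn0.
case/mapP => j; rewrite mem_filter => /andP [j0 /IH].
by case: j j0 => // j _ hj ->; rewrite addnS -addSn.
Qed.

Lemma sat_iter_Ex L (M : structure L) (phi : formula L) k (e : nat -> M) :
  sat e phi -> sat (M := M) (fun i => e (i + k)) (iter k (@Ex L) phi).
Proof.
move=> h; elim: k => [|k IH] /=.
  by apply: (eq_sat (M := M) _).1 h => i _; rewrite addn0.
exists (e k); apply: (eq_sat (M := M) _).1 IH => -[|i] _ //=.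
by rewrite addnS.
Qed.

Lemma iter_Ex_sat L (M : structure L) (phi : formula L) k (e : nat -> M) :
  sat e (iter k (@Ex L) phi) -> exists e' : nat -> M, sat e' phi.
Proof.
elim: k e => [|k IH] e /=; first by exists e.
by case=> a /IH.
Qed.

(** Quantifying existentially over the first [k] variables, where [k] bounds all free variables,
    gives a sentence. The complete theory [T] decides it, so it has the same truth value in [M] and
    in [N]. *)
Lemma satisfiable_transfer L (T : theory L) (M N : structure L) phi :
  is_model M T -> is_model N T ->
  (exists e : nat -> M, sat e phi) -> exists e : nat -> N, sat e phi.
Proof.
move=> hM hN [e he].
have [k hk] := fvars_bound phi.
pose sg := iter k (@Ex L) phi.
have ssg : sentence sg.
  rewrite /sentence; case E: (fvars sg) => [//|i l].
  have /fvars_iter_Ex /hk : i \in fvars sg by rewrite E inE eqxx.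
  by rewrite mem_iota add0n /= ltnNge leq_addl.
have [b] := dom_inh N.
case: (thm_complete T ssg) => [/hN h|/hM h].
  exact: (iter_Ex_sat (h (fun=> b))).
by case: (h (fun i => e (i + k))); apply: sat_iter_Ex.
Qed.

(** A counterexample in any model satisfies [And phi (Not psi)] or the symmetric formula, and its
    satisfiability transfers to [M]. *)
Lemma equivalentP L (T : theory L) (M : structure L) phi psi : is_model M T ->
  equivalent T phi psi <-> forall e : nat -> M, sat e phi <-> sat e psi.
Proof.
move=> hM; split=> [h e|h N hN e]; first exact: h.
split=> h1; apply: contrapT => h2.
- have [] := satisfiable_transfer (phi := And phi (Not psi)) hN hM.
    by exists e.
  by move=> e' /= []; rewrite h.
- have [] := satisfiable_transfer (phi := And psi (Not phi)) hN hM.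
    by exists e.
  by move=> e' /= []; rewrite h.
Qed.

Lemma model_thmP L (T : theory L) (M : structure L) phi : is_model M T ->
  T phi <-> true_sentence M phi.
Proof.
move=> hM; split=> [h|[s h]]; first by split; [exact: thm_sentence h | exact: hM].
case: (thm_complete T s) => // /hM hn.
have [a] := dom_inh M.
by case: (hn (fun=> a) (h _)).
Qed.

Lemma is_model_Th L (M : structure L) : is_model M (Th M).
Proof. by move=> phi []. Qed.

(** * Systems of definable sets of assignments *)

Definition eset (A : Type) := (nat -> A) -> Prop.

Lemma eset_ext A (X Y : eset A) : (forall e, X e <-> Y e) -> X = Y.
Proof. by move=> h; apply/funext => e; apply/propext. Qed.

Definition supported A (S : seq nat) (X : eset A) :=
  forall e e', {in S, e =1 e'} -> X e -> X e'.

Inductive bcl A (G : eset A -> Prop) : eset A -> Prop :=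
| bcl_base X : G X -> bcl G X
| bcl_not X : bcl G X -> bcl G (fun e => ~ X e)
| bcl_and X Y : bcl G X -> bcl G Y -> bcl G (fun e => X e /\ Y e).

Lemma bcl_or A (G : eset A -> Prop) X Y :
  bcl G X -> bcl G Y -> bcl G (fun e => X e \/ Y e).
Proof.
move=> hX hY.
have := bcl_not (bcl_and (bcl_not hX) (bcl_not hY)).
congr bcl; apply: eset_ext => e; split; last by tauto.
by move=> h; apply: contrapT => ?; apply: h; tauto.
Qed.

Lemma bcl_preim A B (G : eset A -> Prop) (H : eset B -> Prop)
    (F : (nat -> A) -> nat -> B) X :
  (forall Y, H Y -> bcl G (Y \o F)) -> bcl H X -> bcl G (X \o F).
Proof.
move=> hG; elim=> [{}X /hG //|{}X _ /bcl_not //|{}X Y _ hX _ hY].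
exact: (bcl_and hX hY).
Qed.

(** Closure properties of the definable sets of a structure, stated without a language, so that they
    also make sense for traces on a subset. By [definable_sys] every such family is the family of
    definable sets of some relational structure. *)
Record defsys A (D : eset A -> Prop) : Prop := Defsys {
  ds_eq : forall i j, D (fun e => e i = e j);
  ds_not : forall X, D X -> D (fun e => ~ X e);
  ds_and : forall X Y, D X -> D Y -> D (fun e => X e /\ Y e);
  ds_ex : forall X, D X -> D (fun e => exists a, X (scons a e));
  ds_rename : forall X (s : nat -> nat), D X -> D (fun e => X (e \o s));
  ds_supported : forall X, D X -> exists k, supported (iota 0 k) X }.

Definition definable L (M : structure L) (X : eset M) : Prop :=
  exists phi, X = fun e => sat e phi.

Lemma definable_defsys L (M : structure L) : defsys (@definable L M).
Proof.
split.
- by move=> i j; exists (Eq (Var i) (Var j)).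
- by move=> _ [p ->]; exists (Not p).
- by move=> _ _ [p ->] [q ->]; exists (And p q).
- by move=> _ [p ->]; exists (Ex p).
- by move=> _ s [p ->]; exists (rename s p); apply: eset_ext => e; rewrite sat_rename.
- move=> _ [p ->]; have [k hk] := fvars_bound p; exists k => e e' h.
  by apply: (eq_sat (M := M) _).1 => i /hk; exact: h.
Qed.

Lemma ds_or A (D : eset A -> Prop) X Y : defsys D ->
  D X -> D Y -> D (fun e => X e \/ Y e).
Proof.
move=> hD hX hY.
have := ds_not hD (ds_and hD (ds_not hD hX) (ds_not hD hY)).
congr D; apply: eset_ext => e; split; last by tauto.
by move=> h; apply: contrapT => ?; apply: h; tauto.
Qed.

Lemma ds_const A (D : eset A -> Prop) (P : Prop) : defsys D -> D (fun=> P).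
Proof.
move=> hD; have hT := ds_eq hD 0 0.
case: (pselect P) => hP; [move: hT | move: (ds_not hD hT)];
  by congr D; apply: eset_ext => e; split.
Qed.

(** Induction on formulas: without function symbols all terms are variables, so [hr] and [ds_eq]
    cover the atomic formulas. *)
Lemma definable_sub L (M : structure L) (D : eset M -> Prop) X :
  (Defs.fsym L -> False) -> defsys D ->
  (forall (r : rsym L) (s : 'I_(rarity r) -> nat),
     D (fun e => rint (fun i => e (s i)))) ->
  definable X -> D X.
Proof.
move=> hL hD hr [phi ->] {X}.
have tV (t : term L) : exists i, t = Var i by case: t => [i|f]; [exists i | case: (hL f)].
elim: phi => [t u|r ts|p IH|p IHp q IHq|p IH] /=.
- by have [[i ->] [j ->]] := (tV t, tV u); exact: ds_eq.
- have [s hs] := choice (fun i => tV (ts i)).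
  move: (hr r s); congr D; apply: eset_ext => e.
  by rewrite (_ : (fun i => teval e (ts i)) = (fun i => e (s i))) //;
    apply/funext => i; rewrite hs.
- exact (ds_not hD IH).
- exact (ds_and hD IHp IHq).
- exact (ds_ex hD IH).
Qed.

(** Semantic form of the generators in [almost_nary]: dependence on at most [n] variables is
    expressed by support, and substitution of variables becomes composition with [s]. *)
Definition sys_generators A (D : eset A -> Prop) n m (Y : 'I_m -> eset A)
    (Z : eset A) : Prop :=
  (D Z /\ exists2 S : seq nat, size S <= n & supported S Z) \/
  exists i (s : nat -> nat), Z = fun e => Y i (e \o s).

Definition almost_nary_sys A (D : eset A -> Prop) n : Prop :=
  exists m (Y : 'I_m -> eset A), (forall i, D (Y i)) /\
    forall X, D X -> bcl (sys_generators D n Y) X.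

(* When [S] is empty all variables are sent to the variable 0: this is where
   [0 < n] is needed. *)
Definition redirect (S : seq nat) i := if i \in S then i else head 0 S.

Lemma redirect_size (S : seq nat) n (l : seq nat) : 0 < n -> size S <= n ->
  (forall j, j \in l -> exists i, j = redirect S i) -> size (undup l) <= n.
Proof.
move=> n0 hS hl.
have h : {subset undup l <= (if nilp S then [:: 0] else S)}.
  move=> i; rewrite mem_undup => /hl [j ->].
  rewrite /redirect; case: S {hS hl} => //= x S.
  by case: ifP => // _; rewrite inE eqxx.
apply: leq_trans (uniq_leq_size (undup_uniq l) h) _.
by case: ifP.
Qed.

Lemma supported_redirect A (S : seq nat) (X : eset A) :
  supported S X -> X = fun e => X (e \o redirect S).
Proof.
move=> hX; apply: eset_ext => e; split; apply: hX => i hi;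
  by rewrite /= /redirect hi.
Qed.

(** A defining formula may mention variables outside [S]. Redirecting them keeps the set, because of
    the support, and makes the formula syntactically small. *)
Lemma definable_small L (M : structure L) n (S : seq nat) (X : eset M) :
  0 < n -> size S <= n -> supported S X -> definable X ->
  exists2 chi, num_fvars chi <= n & X = fun e => sat e chi.
Proof.
move=> n0 hS sX [phi hX]; exists (rename (redirect S) phi).
  apply: (redirect_size n0 hS) => j /mem_fvars_rename [i _ ->].
  by exists i.
rewrite (supported_redirect sX) hX; apply: eset_ext => e.
by rewrite sat_rename.
Qed.

(** Replaces formulas up to equivalence in all models by sets in one model. The Boolean combinations
    inside n-formulas and those outside merge into a single [bcl]. *)
Lemma almost_naryP L (T : theory L) (M : structure L) n :
  is_model M T -> 0 < n ->
  almost_nary T n <-> almost_nary_sys (@definable L M) n.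
Proof.
move=> hM n0; split=> -[m].
- move=> [phis h]; exists m, (fun i e => sat e (phis i)); split.
    by move=> i; exists (phis i).
  move=> _ [phi ->]; have [psi hpsi /(equivalentP _ _ hM) eqv] := h phi.
  rewrite (eset_ext eqv).
  elim: hpsi => {phi psi eqv} [chi [[psi hpsi]|[i [s ->]]]|p _|p q _ hp _ hq].
  + move=> /(equivalentP _ _ hM) /eset_ext ->.
    elim: hpsi => {chi psi} [chi hc|p _|p q _ hp _ hq].
    * apply: bcl_base; left; split; first by exists chi.
      exists (undup (fvars chi)) => // e e' hS.
      by apply: (eq_sat (M := M) _).1 => i hi; apply: hS; rewrite mem_undup.
    * exact: bcl_not.
    * exact: bcl_and.
  + apply: bcl_base; right; exists i, s; apply: eset_ext => e.
    by rewrite sat_rename.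
  + exact: bcl_not.
  + exact: bcl_and.
- move=> [Y [hY h]].
  have [phis hphis] := choice hY.
  exists m, phis => phi.
  have := h _ (ex_intro _ phi erefl).
  suff H X : bcl (sys_generators (@definable L M) n Y) X ->
      exists2 psi, bool_comb (fun chi => nary_formula T n chi \/
                 exists (i : 'I_m) (s : nat -> nat), chi = rename s (phis i)) psi
      & X = fun e => sat e psi.
    move=> /H [psi hpsi E]; exists psi => //; apply/(equivalentP _ _ hM) => e.
    by rewrite -[sat e psi]/((fun e => sat e psi) e) -E.
  elim=> {X} [X [[dX [S hS sX]]|[i [s ->]]]|X _ [p hp ->]|X Z _ [p hp ->] _ [q hq ->]].
  + have [chi hc ->] := definable_small n0 hS sX dX.
    exists chi => //; apply: bc_base; left; exists chi; first exact: bc_base.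
    by move=> N _ e.
  + exists (rename s (phis i)); first by apply: bc_base; right; exists i, s.
    by apply: eset_ext => e; rewrite sat_rename hphis.
  + by exists (Not p) => //; apply: bc_not.
  + by exists (And p q) => //; apply: bc_and.
Qed.

Lemma almost_nary_mono L (T : theory L) n n' :
  n <= n' -> almost_nary T n -> almost_nary T n'.
Proof.
move=> nn' [m [phis h]]; exists m, phis => phi.
have [psi hpsi eqv] := h phi; exists psi => // {eqv h phi}.
elim: hpsi => {psi} [chi [[psi hpsi eqv]|hc]|p _|p q _ hp _ hq].
- apply: bc_base; left; exists psi => // {eqv chi}.
  elim: hpsi => {psi} [chi hc|p _|p q _ hp _ hq].
  + by apply: bc_base; apply: leq_trans nn'.
  + exact: bc_not.
  + exact: bc_and.
- by apply: bc_base; right.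
- exact: bc_not.
- exact: bc_and.
Qed.

(** * Traces on subsets *)

Definition trace A B (f : A -> B) (D : eset B -> Prop) (X : eset A) : Prop :=
  exists2 Y, D Y & X = fun e => Y (f \o e).

Lemma comp_scons A B (f : A -> B) a e : f \o scons a e = scons (f a) (f \o e).
Proof. by apply/funext => -[]. Qed.

(** Injectivity handles equality; definability of the image of [f] allows quantifiers over [A] to be
    expressed as bounded quantifiers over [B]. *)
Lemma trace_defsys A B (f : A -> B) (D : eset B -> Prop) :
  injective f -> defsys D -> D (fun e => exists a, e 0 = f a) ->
  defsys (trace f D).
Proof.
move=> injf hD hf; split.
- move=> i j; exists (fun e => e i = e j); first exact (ds_eq hD i j).
  by apply: eset_ext => e; split=> /= [->//|/injf].
- by move=> _ [Y hY ->]; exists (fun e => ~ Y e); first exact (ds_not hD hY).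
- move=> _ _ [Y hY ->] [Z hZ ->].
  by exists (fun e => Y e /\ Z e); first exact (ds_and hD hY hZ).
- move=> _ [Y hY ->].
  exists (fun e => exists b, (exists a, scons b e 0 = f a) /\ Y (scons b e)).
    exact (ds_ex hD (ds_and hD hf hY)).
  apply: eset_ext => e; split=> [[a]|[b [[a /= ->]]]].
    by rewrite comp_scons => ha; exists (f a); split => //; exists a.
  by rewrite -comp_scons => ha; exists a.
- by move=> _ s [Y hY ->]; exists (fun e => Y (e \o s)); first exact (ds_rename hD s hY).
- move=> _ [Y hY ->]; have [k hk] := ds_supported hD hY; exists k => e e' h.
  by apply: hk => i /h /= ->.
Qed.

(** Pulling sets back along [f \o _] commutes with Boolean operations and with renaming, and
    preserves supports, so generators pull back to generators. *)
Lemma almost_nary_trace A B (f : A -> B) (DA : eset A -> Prop) (DB : eset B -> Prop) n :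
  (forall X, DA X <-> trace f DB X) ->
  almost_nary_sys DB n -> almost_nary_sys DA n.
Proof.
move=> hD [m [Y [hY h]]].
exists m, (fun i e => Y i (f \o e)); split.
  by move=> i; apply/hD; exists (Y i).
move=> X /hD [Z /h hZ ->].
apply: (bcl_preim (F := fun e => f \o e) _ hZ) => {hZ}Z [[dZ [S hS sZ]]|[i [s ->]]].
  apply: bcl_base; left; split; first by apply/hD; exists Z.
  by exists S => // e e' hE; apply: sZ => i /hE /= ->.
by apply: bcl_base; right; exists i, s.
Qed.
(** * Separation of formulas over a disjoint union *)

Definition tvar (L : rel_language) (t : term L) : nat :=
  match t with Var i => i | App f _ => match f with end end.

Lemma tvarE (L : rel_language) (t : term L) : t = Var (tvar t).
Proof. by case: t => // -[]. Qed.

Section Separation.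
Variables L1 L2 : rel_language.

Definition merge (M1 : structure L1) (M2 : structure L2) (p : nat -> bool)
    (e1 : nat -> M1) (e2 : nat -> M2) : nat -> dunion M1 M2 :=
  fun i => if p i then inl (e1 i) else inr (e2 i).

Fixpoint sat_rects (M1 : structure L1) (M2 : structure L2)
    (e1 : nat -> M1) (e2 : nat -> M2) (l : seq (formula L1 * formula L2)) : Prop :=
  if l is ab :: l' then sat e1 ab.1 /\ sat e2 ab.2 \/ sat_rects e1 e2 l'
  else False.

(** The list [l] is chosen before the structures; [dunion_transfer] depends on this uniformity. *)
Definition separable (Q : forall (M1 : structure L1) (M2 : structure L2),
    (nat -> M1) -> (nat -> M2) -> Prop) : Prop :=
  exists l, forall (M1 : structure L1) (M2 : structure L2)
    (e1 : nat -> M1) (e2 : nat -> M2), Q M1 M2 e1 e2 <-> sat_rects e1 e2 l.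

Lemma separable_ext Q Q' :
  (forall (M1 : structure L1) (M2 : structure L2)
     (e1 : nat -> M1) (e2 : nat -> M2), Q' M1 M2 e1 e2 <-> Q M1 M2 e1 e2) ->
  separable Q -> separable Q'.
Proof. by move=> h [l hl]; exists l => M1 M2 e1 e2; rewrite h hl. Qed.

Lemma separable_rect a b :
  separable (fun M1 M2 e1 e2 => sat e1 a /\ sat e2 b).
Proof. by exists [:: (a, b)] => M1 M2 e1 e2 /=; tauto. Qed.

Lemma separable_false : separable (fun M1 M2 e1 e2 => False).
Proof. by exists [::]. Qed.

Definition truef L : formula L := Eq (Var 0) (Var 0).

Lemma separable_true : separable (fun M1 M2 e1 e2 => True).
Proof.
by apply: separable_ext (separable_rect (truef L1) (truef L2)).
Qed.

Lemma separable_or Q Q' : separable Q -> separable Q' ->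
  separable (fun M1 M2 e1 e2 => Q M1 M2 e1 e2 \/ Q' M1 M2 e1 e2).
Proof.
move=> [l hl] [l' hl']; exists (l ++ l') => M1 M2 e1 e2; rewrite hl hl' {hl hl'}.
by elim: l => /= [|a l IH]; rewrite -?IH; tauto.
Qed.

Lemma separable_and Q Q' : separable Q -> separable Q' ->
  separable (fun M1 M2 e1 e2 => Q M1 M2 e1 e2 /\ Q' M1 M2 e1 e2).
Proof.
move=> [l hl] [l' hl'].
suff: separable (fun M1 M2 e1 e2 => sat_rects e1 e2 l /\ sat_rects e1 e2 l').
  by apply: separable_ext => M1 M2 e1 e2; rewrite hl hl'.
move=> {hl hl' Q Q'}; elim: l => [|a l IH] /=.
  by apply: separable_ext separable_false => M1 M2 e1 e2; tauto.
suff h : separable (fun M1 M2 e1 e2 =>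
    (sat e1 a.1 /\ sat e2 a.2) /\ sat_rects e1 e2 l').
  by apply: separable_ext (separable_or h IH) => M1 M2 e1 e2; tauto.
elim: l' {IH} => [|b l' IH] /=.
  by apply: separable_ext separable_false => M1 M2 e1 e2; tauto.
have h := separable_rect (And a.1 b.1) (And a.2 b.2).
by apply: separable_ext (separable_or h IH) => M1 M2 e1 e2 /=; tauto.
Qed.

(** The complement of a rectangle is the union of two strips, each constraining one side only; De
    Morgan then gives an intersection of such unions. *)
Lemma separable_not Q : separable Q ->
  separable (fun M1 M2 e1 e2 => ~ Q M1 M2 e1 e2).
Proof.
move=> [l hl].
suff: separable (fun M1 M2 e1 e2 => ~ sat_rects e1 e2 l).
  by apply: separable_ext => M1 M2 e1 e2; rewrite hl.
move=> {hl Q}; elim: l => [|a l IH] /=.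
  by apply: separable_ext separable_true => M1 M2 e1 e2; tauto.
have h1 := separable_rect (Not a.1) (truef L2).
have h2 := separable_rect (truef L1) (Not a.2).
apply: separable_ext (separable_and (separable_or h1 h2) IH) => M1 M2 e1 e2 /=.
have [] := pselect (sat e1 a.1); have [] := pselect (sat e2 a.2); tauto.
Qed.

(** The existential quantifier distributes over unions, and on a rectangle the two witnesses are
    chosen independently. *)
Lemma separable_ex Q : separable Q ->
  separable (fun M1 M2 e1 e2 => exists a b, Q M1 M2 (scons a e1) (scons b e2)).
Proof.
move=> [l hl].
suff: separable (fun M1 M2 e1 e2 =>
    exists a b, sat_rects (M1 := M1) (M2 := M2) (scons a e1) (scons b e2) l).
  apply: separable_ext => M1 M2 e1 e2.
  by split=> -[a [b h]]; exists a, b; apply/hl.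
move=> {hl Q}; elim: l => [|c l IH] /=.
  by apply: separable_ext separable_false => M1 M2 e1 e2; split=> // -[? []].
have h := separable_rect (Ex c.1) (Ex c.2).
apply: separable_ext (separable_or h IH) => M1 M2 e1 e2 /=; split.
  by move=> [a [b [[ha hb]|hab]]]; [left; split; [exists a|exists b] | right; exists a, b].
by move=> [[[a ha] [b hb]]|[a [b hab]]]; exists a, b; tauto.
Qed.

(* For a fixed distribution [p] of the variables among the two parts, a formula
   over the disjoint union is a finite disjunction of rectangles. *)
Lemma separable_dunion p (phi : formula (dunion_language L1 L2)) :
  separable (fun M1 M2 e1 e2 => sat (merge p e1 e2) phi).
Proof.
elim: phi p => [t u|r ts|q IH|q IHq q' IHq'|q IH] p /=.
- rewrite (tvarE t) (tvarE u) /=; move: (tvar t) (tvar u) => i j {t u}.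
  rewrite /merge; case: (p i); case: (p j).
  + apply: separable_ext (separable_rect (Eq (Var i) (Var j)) (truef L2)).
    by move=> M1 M2 e1 e2 /=; split=> [[->]|[-> _]].
  + by apply: separable_ext separable_false.
  + by apply: separable_ext separable_false.
  + apply: separable_ext (separable_rect (truef L1) (Eq (Var i) (Var j))).
    by move=> M1 M2 e1 e2 /=; split=> [[->]|[_ ->]].
- pose s i := tvar (ts i).
  have Es (M1 : structure L1) (M2 : structure L2) (e1 : nat -> M1) (e2 : nat -> M2) :
      (fun i => teval (merge p e1 e2) (ts i)) = merge p e1 e2 \o s.
    by apply/funext => i; rewrite (tvarE (ts i)).
  case: r ts @s Es => [[q|q]|b] ts s Es /=.
  (* With all arguments in the first part this is an atom over [L1]; otherwise it is false, since
     symbols of [L1] hold only of tuples from the first part. *)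
  + have [hp|[i hi]] : (forall i, p (s i)) \/ exists i, ~~ p (s i).
      by have [|/existsNP[i /negP]] := pselect (forall i, p (s i)); [left|right; exists i].
    * apply: separable_ext (separable_rect
        (@Rel L1 q (fun i => Var (s i))) (truef L2)) => M1 M2 e1 e2 /=.
      rewrite Es; split=> [[v hv hq]|[hq _]]; last first.
        by exists (e1 \o s) => //; apply/funext => i; rewrite /= /merge hp.
      split=> //; rewrite (_ : (fun i => e1 (s i)) = v) //; apply/funext => i.
      by have := congr1 (fun g => g i) hv; rewrite /= /merge hp => -[].
    * apply: separable_ext separable_false => M1 M2 e1 e2; rewrite Es; split=> // -[v hv _].
      by have := congr1 (fun g => g i) hv; rewrite /= /merge (negbTE hi).
  + have [hp|[i hi]] : (forall i, ~~ p (s i)) \/ exists i, p (s i).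
      have [|/existsNP[i /negP]] := pselect (forall i, ~~ p (s i)); first by left.
      by rewrite negbK; right; exists i.
    * apply: separable_ext (separable_rect
        (truef L1) (@Rel L2 q (fun i => Var (s i)))) => M1 M2 e1 e2 /=.
      rewrite Es; split=> [[v hv hq]|[_ hq]]; last first.
        by exists (e2 \o s) => //; apply/funext => i; rewrite /= /merge (negbTE (hp i)).
      split=> //; rewrite (_ : (fun i => e2 (s i)) = v) //; apply/funext => i.
      by have := congr1 (fun g => g i) hv; rewrite /= /merge (negbTE (hp i)) => -[].
    * apply: separable_ext separable_false => M1 M2 e1 e2; rewrite Es; split=> // -[v hv _].
      by have := congr1 (fun g => g i) hv; rewrite /= /merge hi.
  + suff h : separable (fun M1 M2 e1 e2 =>
        dunion_rint (merge (M1 := M1) (M2 := M2) p e1 e2 \o s)).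
      by apply: separable_ext h => M1 M2 e1 e2; rewrite Es.
    case: b ts @s {Es} => ts s; case E: (p (s ord0)).
    * apply: separable_ext separable_false => M1 M2 e1 e2.
      by rewrite /= /merge E; split=> // -[].
    * apply: separable_ext separable_true => M1 M2 e1 e2.
      by rewrite /= /merge E; split=> // _; exists (e2 (s ord0)).
    * apply: separable_ext separable_true => M1 M2 e1 e2.
      by rewrite /= /merge E; split=> // _; exists (e1 (s ord0)).
    * apply: separable_ext separable_false => M1 M2 e1 e2.
      by rewrite /= /merge E; split=> // -[].
- exact: separable_not.
- exact: separable_and.
- have hT := separable_ex (IH (scons true p)).
  have hF := separable_ex (IH (scons false p)).
  have Em (M1 : structure L1) (M2 : structure L2) (e1 : nat -> M1) (e2 : nat -> M2)
      c a b : scons (if c is true then inl a else inr b) (merge p e1 e2) =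
              merge (scons c p) (scons a e1) (scons b e2).
    by apply/funext => -[|i] //=; case: c.
  apply: separable_ext (separable_or hT hF) => M1 M2 e1 e2.
  split=> [[[a|b] h]|[[a [b h]]|[a [b h]]]].
  + have [b] := dom_inh M2; left; exists a, b.
    by rewrite -(Em M1 M2 e1 e2 true a b).
  + have [a] := dom_inh M1; right; exists a, b.
    by rewrite -(Em M1 M2 e1 e2 false a b).
  + by exists (inl a); rewrite (Em M1 M2 e1 e2 true a b).
  + by exists (inr b); rewrite (Em M1 M2 e1 e2 false a b).
Qed.

(** The theory of the union depends only on [T1] and [T2]: a sentence amounts to the satisfiability
    of one of finitely many rectangles, and the two sides of a rectangle transfer separately. *)
Lemma dunion_transfer (T1 : theory L1) (T2 : theory L2)
    (M1 N1 : structure L1) (M2 N2 : structure L2) phi :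
  is_model M1 T1 -> is_model N1 T1 -> is_model M2 T2 -> is_model N2 T2 ->
  true_sentence (dunion M1 M2) phi -> true_sentence (dunion N1 N2) phi.
Proof.
move=> hM1 hN1 hM2 hN2 [sphi h]; split=> // e.
have [l hl] := separable_dunion (fun=> true) phi.
have [[a] [b]] := (dom_inh M1, dom_inh M2).
have /hl hab := h (merge (fun=> true) (fun=> a) (fun=> b)).
suff [e1 [e2 /hl]] : exists (e1 : nat -> N1) (e2 : nat -> N2), sat_rects e1 e2 l.
  by apply: (eq_sat (M := dunion N1 N2) _).1; rewrite (nilP sphi).
elim: l {hl} hab => //= c l IH [[h1 h2]|/IH [e1 [e2 h12]]]; last by exists e1, e2; right.
have [e1 h1'] := satisfiable_transfer hM1 hN1 (ex_intro (fun e => sat e c.1) _ h1).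
have [e2 h2'] := satisfiable_transfer hM2 hN2 (ex_intro (fun e => sat e c.2) _ h2).
by exists e1, e2; left.
Qed.

End Separation.

(** * Relativization *)

Section Relativization.
Variables (L K : rel_language) (P : psym K) (g : psym L -> psym K).
Hypothesis hg : forall q, parity (g q) = parity q.

(** More general than being a summand of [dunion]: this notion survives in every model of the theory
    of [N], hence in models of expansions, which need not be literal disjoint unions. *)
Record is_part (A : structure L) (N : structure K) (f : A -> N) : Prop := IsPart {
  part_inj : injective f;
  part_dom : forall y, @rint K N P (fun=> y) <-> exists a, y = f a;
  part_rel : forall q (v : 'I_(parity q) -> A),
    @rint L A q v <-> @rint K N (g q) (fun i => f (v (cast_ord (hg q) i))) }.

Fixpoint relat (phi : formula L) : formula K :=
  match phi with
  | Eq t u => Eq (Var (tvar t)) (Var (tvar u))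
  | Rel q ts => @Rel K (g q) (fun i => Var (tvar (ts (cast_ord (hg q) i))))
  | Not p => Not (relat p)
  | And p q => And (relat p) (relat q)
  | Ex p => Ex (And (@Rel K P (fun=> Var 0)) (relat p))
  end.

Lemma sat_relat (A : structure L) (N : structure K) (f : A -> N) phi (e : nat -> A) :
  is_part f -> sat e phi <-> sat (M := N) (f \o e) (relat phi).
Proof.
move=> hf; elim: phi e => [t u|q ts|p IH|p IHp q IHq|p IH] e /=.
- rewrite {1}(tvarE t) {1}(tvarE u) /=.
  by split=> [->//|/(part_inj hf)].
- rewrite (part_rel hf) /=.
  rewrite (_ : (fun i => f _) =
    (fun i => f (e (tvar (ts (cast_ord (hg q) i)))))) //.
  by apply/funext => i; rewrite {1}(tvarE (ts _)).
- by rewrite IH.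
- by rewrite IHp IHq.
- split=> [[a /IH]|[y [/(part_dom hf) [a /= ->]]]].
    by rewrite comp_scons => h; exists (f a); split => //; apply/(part_dom hf); exists a.
  by rewrite -comp_scons => /IH h; exists a.
Qed.

Lemma fvars_relat phi : {subset fvars (relat phi) <= fvars phi}.
Proof.
elim: phi => [t u|q ts|p IH|p IHp q IHq|p IH] i //=.
- by rewrite {2}(tvarE t) {2}(tvarE u).
- case/flatten_mapP => j _ /=; rewrite inE => /eqP ->.
  apply/flatten_mapP; exists (cast_ord (hg q) j); first by rewrite mem_enum.
  by rewrite {2}(tvarE (ts _)) inE.
- exact: IH.
- by rewrite !mem_cat => /orP [/IHp|/IHq] ->; rewrite ?orbT.
- case/mapP => j; rewrite mem_filter mem_cat => /andP [j0 /orP [|/IH hj ->]].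
    by case/flatten_mapP => k _; rewrite inE => /eqP ej; rewrite ej in j0.
  by apply/mapP; exists j; rewrite // mem_filter j0.
Qed.

Lemma definable_part (A : structure L) (N : structure K) (f : A -> N) X :
  is_part f -> definable X -> trace f (@definable K N) X.
Proof.
move=> hf [phi ->]; exists (fun e => sat e (relat phi)); first by exists (relat phi).
by apply: eset_ext => e; rewrite (sat_relat _ _ hf).
Qed.

Lemma definable_part_dom (A : structure L) (N : structure K) (f : A -> N) :
  is_part f -> @definable K N (fun e => exists a, e 0 = f a).
Proof.
move=> hf; exists (@Rel K P (fun=> Var 0)); apply: eset_ext => e /=.
by rewrite (part_dom hf).
Qed.

(** [A'] is the set defined by [P] in [N'] with the induced relations. The relativized theorems of
    [T] are sentences true in [N], hence true in [N']. *)
Lemma part_transfer (T : theory L) (A : structure L) (N N' : structure K) (f : A -> N) :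
  is_model A T -> is_part f -> is_model N' (Th N) ->
  exists (A' : structure L) (f' : A' -> N'), is_part f' /\ is_model A' T.
Proof.
move=> hA hf hN'; have [a] := dom_inh A.
(* That [P] is nonempty is itself transferred from [N], which provides an element of the domain of
   [A']. *)
have [e he] : exists e : nat -> N', sat e (@Rel K P (fun=> Var 0)).
  apply: (satisfiable_transfer (@is_model_Th _ N) hN').
  by exists (fun=> f a) => /=; apply/(part_dom hf); exists a.
pose A' := @Structure L {y : N' | @rint K N' P (fun=> y)}
  (inhabits (exist _ (e 0) he)) (fun h => match h with end)
  (fun q v => @rint K N' (g q) (fun i => sval (v (cast_ord (hg q) i)))).
have hf' : @is_part A' N' (fun x => sval x).
  split=> // [[x hx] [y hy] /= E|y].
    by move: hx hy; rewrite E => hx hy; rewrite (Prop_irrelevance hx hy).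
  by split=> [hy|[[z hz] /= ->]] //; exists (exist _ y hy).
exists A', (fun x => sval x); split=> // phi hphi e'.
apply/(sat_relat _ _ hf').
apply: hN'; split=> [|e''].
  rewrite /sentence; have := @fvars_relat phi.
  rewrite (nilP (thm_sentence hphi)); case: (fvars _) => // i l /(_ i).
  by rewrite inE eqxx => /(_ isT).
have/(sat_relat _ _ hf) := hA _ hphi (fun=> a).
apply: (eq_sat (M := N) _).1 => i /fvars_relat.
by rewrite (nilP (thm_sentence hphi)).
Qed.

End Relativization.

(** * The two summands as parts of a disjoint union *)

Section Parts.
Variables (L1 L2 : rel_language) (M1 : structure L1) (M2 : structure L2).
Let K := dunion_language L1 L2.

Lemma is_part_inl : @is_part L1 K (inr false) (fun q => inl (inl q))
  (fun=> erefl) M1 (dunion M1 M2) (@inl M1 M2).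
Proof.
split=> [x y []|y|q v] //=.
split=> [h|[w hw]].
  by exists v => //; apply/funext => i; rewrite cast_ord_id.
suff -> : v = w by [].
by apply/funext => i; have := congr1 (fun g => g i) hw; rewrite /= cast_ord_id => -[].
Qed.

Lemma is_part_inr : @is_part L2 K (inr true) (fun q => inl (inr q))
  (fun=> erefl) M2 (dunion M1 M2) (@inr M1 M2).
Proof.
split=> [x y []|y|q v] //=.
split=> [h|[w hw]].
  by exists v => //; apply/funext => i; rewrite cast_ord_id.
suff -> : v = w by [].
by apply/funext => i; have := congr1 (fun g => g i) hw; rewrite /= cast_ord_id => -[].
Qed.

(** Once one side is frozen, its conditions are constant truth values and a slice of a union of
    rectangles remains. *)
Lemma sat_rects_definable l :
  (forall e2, @definable L1 M1 (fun e1 => @sat_rects L1 L2 M1 M2 e1 e2 l)) /\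
  (forall e1, @definable L2 M2 (fun e2 => @sat_rects L1 L2 M1 M2 e1 e2 l)).
Proof.
have h1 := definable_defsys M1; have h2 := definable_defsys M2.
elim: l => [|c l [IH1 IH2]]; split=> e /=; do ?exact: ds_const.
- apply: (ds_or h1); last exact: IH1.
  by apply: (ds_and h1); [exists c.1 | apply: ds_const].
- apply: (ds_or h2); last exact: IH2.
  by apply: (ds_and h2); [apply: ds_const | exists c.2].
Qed.

(** Relativization gives one direction. For the other, all variables are placed in the first part
    and the second side of the rectangles is frozen. *)
Lemma definable_trace_inl (X : eset M1) :
  definable X <-> trace (@inl M1 M2) (@definable _ (dunion M1 M2)) X.
Proof.
split=> [|[_ [phi ->] ->]]; first exact: definable_part is_part_inl.
have [[l hl] [b]] := (separable_dunion (fun=> true) phi, dom_inh M2).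
have := (sat_rects_definable l).1 (fun=> b); congr definable.
by apply: eset_ext => e; rewrite -hl.
Qed.

Lemma definable_trace_inr (X : eset M2) :
  definable X <-> trace (@inr M1 M2) (@definable _ (dunion M1 M2)) X.
Proof.
split=> [|[_ [phi ->] ->]]; first exact: definable_part is_part_inr.
have [[l hl] [a]] := (separable_dunion (fun=> false) phi, dom_inh M1).
have := (sat_rects_definable l).2 (fun=> a); congr definable.
by apply: eset_ext => e; rewrite -hl.
Qed.

End Parts.

(** * Almost n-arity of disjoint unions *)

(** Case analysis on the truth values of [U 0], ..., [U k.-1]: each step glues the two solutions for
    the last value using [U k] and its complement. *)
Lemma bcl_cases A (G : eset A -> Prop) (U : nat -> eset A) X k :
  (forall i, bcl G (U i)) ->
  (forall p : nat -> bool, exists2 Z, bcl G Z &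
     forall e, (forall i, i < k -> p i <-> U i e) -> X e <-> Z e) ->
  bcl G X.
Proof.
move=> hU; elim: k => [|k IH] h.
  have [Z hZ E] := h xpredT; suff -> : X = Z by [].
  by apply: eset_ext => e; apply: E.
apply: IH => p.
pose q (b : bool) (i : nat) := if i == k then b else p i.
have [[Z1 h1 E1] [Z0 h0 E0]] := (h (q true), h (q false)).
exists (fun e => (U k e /\ Z1 e) \/ (~ U k e /\ Z0 e)).
  by apply: bcl_or; apply: bcl_and => //; apply: bcl_not.
move=> e he.
have hq (b : bool) i : (b <-> U k e) -> i < k.+1 -> q b i <-> U i e.
  move=> hb; rewrite /q ltnS leq_eqVlt; case: eqP => [->//|_ /= ]; exact: he.
have [hk|hk] := pselect (U k e).
  rewrite (E1 e (fun i => hq true i _)); last by split.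
  by tauto.
rewrite (E0 e (fun i => hq false i _)); last by split.
by tauto.
Qed.

(** * Transporting Boolean combinations from one part to the union *)

Section Side.
Variables (A B : Type) (f : A -> B) (DA : eset A -> Prop) (DB : eset B -> Prop).
Variables (n m : nat) (Y : 'I_m -> eset A) (Y' : 'I_m -> eset B) (G : eset B -> Prop).
Hypotheses (hDB : defsys DB) (n0 : 0 < n).
Hypothesis hAB : forall X, DA X -> trace f DB X.
Hypothesis hY : forall i, Y i = fun e => Y' i (f \o e).
Hypothesis hG : forall Z S, DB Z -> size S <= n -> supported S Z -> G Z.
Hypothesis hGY : forall i (s : nat -> nat), G (fun e => Y' i (e \o s)).

(** The variables are read through [s], whose values are meant to point at variables lying in the
    part. A support [S] then becomes its image under [s], which is no larger. *)
Lemma bcl_transport (s : nat -> nat) X : bcl (sys_generators DA n Y) X ->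
  exists2 Z, bcl G Z & forall e e1, e \o s = f \o e1 -> Z e <-> X e1.
Proof.
elim=> {X} [X [[dX [S hS sX]]|[i [t ->]]]|X _ [Z hZ E]|X1 X2 _ [Z1 hZ1 E1] _ [Z2 hZ2 E2]].
- have [Z dZ E] := hAB dX.
  exists (fun e => Z (e \o (s \o redirect S))).
    apply: bcl_base.
    (* For empty [S], [redirect] sends every variable to 0, so the set is formally supported by
       [s 0]; its size 1 is at most [n] since [n] is positive. *)
    apply: (@hG _ (if nilp S then [:: s 0] else map s S)).
    + exact (ds_rename hDB (s \o redirect S) dZ).
    + by case: ifP => // _; rewrite size_map.
    + move=> e e' he; suff -> : e \o (s \o redirect S) = e' \o (s \o redirect S) by [].
      apply/funext => i /=; apply: he; rewrite /redirect.
      case: S {hS sX} => [|x S] /=; first by rewrite inE.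
      case: ifP => [hi|_]; last by rewrite inE eqxx.
      exact: (map_f s hi).
  move=> e e1 he.
  rewrite (supported_redirect sX) E.
  by rewrite (_ : e \o (s \o redirect S) = f \o (e1 \o redirect S)) //
    -[LHS]/((e \o s) \o redirect S) he.
- exists (fun e => Y' i (e \o (s \o t))); first by apply: bcl_base; apply: hGY.
  move=> e e1 he; rewrite hY.
  by rewrite (_ : e \o (s \o t) = f \o (e1 \o t)) // -[LHS]/((e \o s) \o t) he.
- by exists (fun e => ~ Z e); [apply: bcl_not | move=> e e1 /E ->].
- exists (fun e => Z1 e /\ Z2 e); first exact: bcl_and.
  by move=> e e1 he; rewrite (E1 _ _ he) (E2 _ _ he).
Qed.

(* The variables outside the part are redirected to a variable inside it; when
   there is none, they get a fixed value and only truth values remain. *)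
Lemma side_values (a : A) (p : nat -> bool) k :
  (forall X, DA X -> bcl (sys_generators DA n Y) X) ->
  let pat e := forall i, i < k -> p i <-> exists a, e i = f a in
  exists F : (nat -> B) -> nat -> A,
    (forall e i, pat e -> i < k -> p i -> e i = f (F e i)) /\
    forall X, DA X -> exists2 Z, bcl G Z & forall e, pat e -> Z e <-> X (F e).
Proof.
move=> hA pat.
(* This yields a left inverse [v] of [f] on its image, arbitrary elsewhere. *)
have ex_preim b : exists x, (exists a, b = f a) -> b = f x.
  by have [[x hx]|h] := pselect (exists a, b = f a); [exists x | exists a].
have [v hv] := choice ex_preim.
have [[j /andP[jk pj]]|hn] := pselect (exists j, (j < k) && p j).
  pose s i := if (i < k) && p i then i else j.
  have hs e : pat e -> e \o s = f \o (fun i => v (e (s i))).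
    move=> he; apply/funext => i; apply: hv; rewrite /= /s.
    by case: ifP => [/andP[ik pi]|_]; [exact: (he i ik).1 | exact: (he j jk).1].
  exists (fun e i => v (e (s i))); split.
    move=> e i he ik pi; have := congr1 (fun h => h i) (hs e he).
    by rewrite /= /s ik pi.
  move=> X /hA /(bcl_transport s) [Z hZ E]; exists Z => // e /hs; exact: E.
exists (fun=> fun=> a); split=> [e i _ ik pi|X dX]; first by case: hn; exists i; rewrite ik.
exists (fun=> X (fun=> a)) => //.
by apply: bcl_base; apply: (@hG _ [::]) => //; apply: ds_const.
Qed.

End Side.

(** For each distribution of the variables, both sides of every rectangle are Boolean combinations
    of transported generators; [bcl_cases] glues the distributions. *)
Lemma almost_nary_dunion (L1 L2 : rel_language) (M1 : structure L1)
    (M2 : structure L2) n : 0 < n ->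
  almost_nary_sys (@definable _ M1) n -> almost_nary_sys (@definable _ M2) n ->
  almost_nary_sys (@definable _ (dunion M1 M2)) n.
Proof.
move=> n0 [m1 [Y1 [dY1 h1]]] [m2 [Y2 [dY2 h2]]].
have t1 X := (@definable_trace_inl L1 L2 M1 M2 X).1.
have t2 X := (@definable_trace_inr L1 L2 M1 M2 X).1.
have ex_Y1 i : exists y : eset (dunion M1 M2),
    definable y /\ Y1 i = fun e => y (inl \o e).
  by have [y] := t1 _ (dY1 i); exists y.
have [Y1' hY1] := choice ex_Y1.
have ex_Y2 i : exists y : eset (dunion M1 M2),
    definable y /\ Y2 i = fun e => y (inr \o e).
  by have [y] := t2 _ (dY2 i); exists y.
have [Y2' hY2] := choice ex_Y2.
(* The special sets of both parts, each extended to the union, are listed one after the other. *)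
pose Y (i : 'I_(m1 + m2)) := match split i with inl j => Y1' j | inr j => Y2' j end.
exists (m1 + m2), Y; split.
  by move=> i; rewrite /Y; case: split => j; [have [] := hY1 j | have [] := hY2 j].
set D := @definable _ _; set G := sys_generators D n Y.
have hD : defsys D := definable_defsys (dunion M1 M2).
have hG Z S : D Z -> size S <= n -> supported S Z -> G Z.
  by move=> dZ hS sZ; left; split=> //; exists S.
have hG1 i s : G (fun e => Y1' i (e \o s)).
  by right; exists (lshift m2 i), s; rewrite /Y (unsplitK (inl i)).
have hG2 i s : G (fun e => Y2' i (e \o s)).
  by right; exists (rshift m1 i), s; rewrite /Y (unsplitK (inr i)).
move=> _ [phi ->]; have [k hk] := fvars_bound phi.
(* The sets saying that variable [i] lies in part 1 are supported by one variable, so they are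
   generators because [n] is positive. *)
apply: (@bcl_cases _ G (fun i e => exists a : M1, e i = inl a) _ k) => [i|p].
  apply: bcl_base; apply: (hG _ [:: i]) => //.
    exact (ds_rename hD (fun=> i) (definable_part_dom (is_part_inl M1 M2))).
  by move=> e e' he [a ha]; exists a; rewrite -he // inE.
have [[a] [b]] := (dom_inh M1, dom_inh M2).
have [F1 [hF1 E1]] := side_values hD n0 t1 (fun i => (hY1 i).2) hG hG1 a p k h1.
have [F2 [hF2 E2]] :=
  side_values hD n0 t2 (fun i => (hY2 i).2) hG hG2 b (fun i => ~~ p i) k h2.
pose pat (e : nat -> dunion M1 M2) :=
  forall i, i < k -> p i <-> exists a : M1, e i = inl a.
have pat2 (e : nat -> dunion M1 M2) : pat e -> forall i, i < k -> ~~ p i <-> exists b : M2, e i = inr b.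
  move=> he i ik; split.
    move=> /negP pi; case E: (e i) => [x|y]; last by exists y.
    by case: pi; apply/(he i ik); exists x.
  by move=> [y hy]; apply/negP => /(he i ik) [x]; rewrite hy.
have [l hl] := separable_dunion p phi.
have [Z hZ EZ] : exists2 Z, bcl G Z &
    forall e, pat e -> Z e <-> sat_rects (F1 e) (F2 e) l.
  elim: l {hl} => [|c l [Z hZ EZ]].
    exists (fun=> False) => //.
    by apply: bcl_base; apply: (hG _ [::]) => //; apply: ds_const.
  have [Z1 hZ1 EZ1] := E1 _ (ex_intro _ c.1 erefl).
  have [Z2 hZ2 EZ2] := E2 _ (ex_intro _ c.2 erefl).
  exists (fun e => (Z1 e /\ Z2 e) \/ Z e).
    by apply: bcl_or => //; apply: bcl_and.
  by move=> e he /=; rewrite (EZ e he) (EZ1 e he) (EZ2 e (pat2 e he)).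
exists Z => // e he; rewrite (EZ e he) -hl.
apply: eq_sat => i /hk; rewrite mem_iota add0n /= => ik.
rewrite /merge; case: ifP => pi.
  exact: hF1.
by apply: hF2; rewrite ?pi //; apply: pat2.
Qed.

Lemma almost_nary_dunionP (L1 L2 : rel_language) (T1 : theory L1) (T2 : theory L2)
    (M1 : structure L1) (M2 : structure L2) n :
  is_model M1 T1 -> is_model M2 T2 -> 0 < n ->
  almost_nary T1 n /\ almost_nary T2 n <-> almost_nary (Th (dunion M1 M2)) n.
Proof.
move=> hM1 hM2 n0; rewrite (almost_naryP hM1 n0) (almost_naryP hM2 n0).
rewrite (almost_naryP (@is_model_Th _ (dunion M1 M2)) n0).
split=> [[h1 h2]|h]; first exact: almost_nary_dunion.
by split; [move: h; apply: almost_nary_trace => X; exact: definable_trace_inl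
          |move: h; apply: almost_nary_trace => X; exact: definable_trace_inr].
Qed.

(** * The least arity of a theory *)

Lemma aar_Some L (T : theory L) n : 0 < n -> almost_nary T n ->
  (forall k, 0 < k -> almost_nary T k -> n <= k) -> aar T = Some n.
Proof.
move=> n0 hn hmin; rewrite /aar; case: pselect => [h|[]]; last first.
  by exists n; rewrite n0; apply/asboolP.
case: ex_minnP => k /andP[k0 /asboolP hk] kmin; congr Some; apply/eqP.
rewrite eqn_leq hmin // andbT; apply: kmin; rewrite n0.
exact/asboolP.
Qed.

Variant aar_spec L (T : theory L) : option nat -> Prop :=
| AarSome n of 0 < n & almost_nary T n
    & (forall k, 0 < k -> almost_nary T k -> n <= k) : aar_spec T (Some n)
| AarNone of (forall k, 0 < k -> ~ almost_nary T k) : aar_spec T None.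

Lemma aarP L (T : theory L) : aar_spec T (aar T).
Proof.
rewrite /aar; case: pselect => [h|h].
  case: ex_minnP => n /andP[n0 /asboolP hn] nmin; constructor => // k k0 hk.
  by apply: nmin; rewrite k0; apply/asboolP.
by constructor => k k0 hk; apply: h; exists k; rewrite k0; apply/asboolP.
Qed.

(** By [almost_nary_mono] the admissible arities of each theory are upward closed, so the maximum of
    the two minima is admissible for both. *)
Lemma aar_conj L L1 L2 (T : theory L) (T1 : theory L1) (T2 : theory L2) :
  (forall n, 0 < n -> almost_nary T1 n /\ almost_nary T2 n <-> almost_nary T n) ->
  aar T = max_infty (aar T1) (aar T2).
Proof.
move=> h.
case: (aarP T1) => [n1 p1 h1 m1|h1]; last first.
  by case: (aarP T) => // k k0 /(h k k0) [/(h1 k k0)].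
case: (aarP T2) => [n2 p2 h2 m2|h2]; last first.
  by case: (aarP T) => // k k0 /(h k k0) [_ /(h2 k k0)].
have p : 0 < maxn n1 n2 by rewrite leq_max p1.
apply: aar_Some => //.
  by apply/(h _ p); split; [apply: almost_nary_mono h1; rewrite leq_maxl
                           |apply: almost_nary_mono h2; rewrite leq_maxr].
by move=> k k0 /(h k k0) [a1 a2]; rewrite geq_max m1 // m2.
Qed.

(** * Expansions *)

Definition reduct L E (M : structure (lang_sum L E)) : structure L :=
  @Structure L M (dom_inh M) (fun f => @fint _ M (inl f)) (fun r => @rint _ M (inl r)).

Lemma teval_tlift L E (M : structure (lang_sum L E)) (e : nat -> M) (t : term L) :
  teval e (tlift E t) = teval (M := reduct M) e t.
Proof.
by elim: t => //= f ts IH; congr fint; apply/funext => i; apply: IH.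
Qed.

Lemma sat_lift L E (M : structure (lang_sum L E)) phi (e : nat -> M) :
  sat e (Defs.lift E phi) <-> sat (M := reduct M) e phi.
Proof.
elim: phi e => [t u|r ts|p IH|p IHp q IHq|p IH] e /=.
- by rewrite !teval_tlift.
- by rewrite (_ : (fun i => teval e _) = (fun i => teval (M := reduct M) e (ts i))) //;
    apply/funext => i; rewrite teval_tlift.
- by rewrite IH.
- by rewrite IHp IHq.
- by split=> -[a /IH h]; exists a.
Qed.

Lemma tvars_tlift L E (t : term L) : tvars (tlift E t) = tvars t.
Proof.
elim: t => //= f ts IH; congr flatten; apply: eq_map => i; exact: IH.
Qed.

Lemma fvars_lift L E (phi : formula L) : fvars (Defs.lift E phi) = fvars phi.
Proof.
elim: phi => [t u|r ts|p IH|p IHp q IHq|p IH] /=; rewrite ?tvars_tlift ?IH ?IHp ?IHq //.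
by congr flatten; apply: eq_map => i; rewrite tvars_tlift.
Qed.

Lemma true_sentence_lift L E (M : structure (lang_sum L E)) phi :
  true_sentence M (Defs.lift E phi) <-> true_sentence (reduct M) phi.
Proof.
rewrite /true_sentence /sentence fvars_lift; split=> -[s h]; split=> // e;
  exact/sat_lift.
Qed.

Lemma reduct_model L E (T : theory L) (T' : theory (lang_sum L E)) M :
  is_expansion T T' -> is_model M T' -> is_model (reduct M) T.
Proof.
move=> hT hM phi /hT /hM h e; exact/sat_lift.
Qed.

Lemma definable_reduct L E (M : structure (lang_sum L E)) X :
  @definable L (reduct M) X -> @definable _ M X.
Proof.
move=> [phi ->]; exists (Defs.lift E phi).
by apply: eset_ext => e; rewrite sat_lift.
Qed.

(** * Structures with a prescribed system of definable sets *)

Section SystemStructure.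
Variables (A : Type) (D : eset A -> Prop).

(* The relation symbols are the members of [D] themselves, each with a bound on
   the variables it depends on. *)
Definition sys_language : rel_language :=
  @RelLanguage {X : eset A & {k | D X /\ supported (iota 0 k) X}}
    (fun r => sval (projT2 r)).

(** By the support condition all extensions [e] of [v] agree on membership; quantifying over them
    avoids a default element of [A]. *)
Definition sys_rint (r : psym sys_language) (v : 'I_(parity r) -> A) : Prop :=
  exists2 e : nat -> A, (forall i : 'I_(parity r), e i = v i) & projT1 r e.

Definition sys_symbol (X : eset A) k (H : D X /\ supported (iota 0 k) X) :
  psym sys_language := existT _ X (exist _ k H).

Lemma sys_rint_rel (hA : inhabited A) k (R : ('I_k -> A) -> Prop) :
  D (fun e => R (fun i => e i)) ->
  exists H, forall v : 'I_k -> A,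
    R v <-> @sys_rint (@sys_symbol (fun e => R (fun i => e i)) k H) v.
Proof.
move=> dR.
have sR : supported (iota 0 k) (fun e => R (fun i => e i)).
  move=> e e' he; suff -> : (fun i : 'I_k => e i) = (fun i => e' i) by [].
  by apply/funext => i; apply: he; rewrite mem_iota add0n /=.
exists (conj dR sR) => v; split=> [hv|[e he /=]]; last first.
  by rewrite (_ : (fun i : 'I_k => e i) = v) //; apply/funext.
have [a] := hA.
by exists (fun j => if insub j is Some i then v i else a);
  [move=> i; rewrite valK | rewrite /= (_ : (fun i : 'I_k => _) = v) //; apply/funext => i; rewrite valK].
Qed.

Hypothesis hD : defsys D.

Lemma sys_rint_in r (s : 'I_(parity r) -> nat) :
  D (fun e => sys_rint (fun i => e (s i))).
Proof.
case: r s => X [k [dX sX]] s.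
(* The default 0 is harmless: [X] depends only on variables below [k]. *)
pose s' j := if insub j is Some i then s i else 0.
have hs' (i : 'I_k) : s' i = s i by rewrite /s' valK.
move: (ds_rename hD s' dX); congr D; apply: eset_ext => e; split=> [h|[e' he']].
  by exists (e \o s') => // i; rewrite /= hs'.
apply: (sX _ _ _) => j; rewrite mem_iota add0n /= => jk.
by rewrite (he' (Ordinal jk)) /= -(hs' (Ordinal jk)).
Qed.

Lemma sys_rint_out X : D X ->
  exists r, X = fun e => @sys_rint r (fun i => e i).
Proof.
move=> dX; have [k sX] := ds_supported hD dX.
exists (sys_symbol (conj dX sX)).
apply: eset_ext => e; split=> [h|[e' he']]; first by exists e.
apply: (sX _ _ _) => j; rewrite mem_iota add0n /= => jk.
exact: (he' (Ordinal jk)).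
Qed.

End SystemStructure.

Definition sys_structure A (D : eset A -> Prop) (hA : inhabited A) :
    structure (sys_language D) :=
  @Structure (sys_language D) A hA (fun f => match f with end) (@sys_rint A D).

(** A Morleyization: the closure properties of [D] ensure that the new symbols define nothing beyond
    [D]. *)
Lemma definable_sys A (D : eset A -> Prop) (hA : inhabited A) : defsys D ->
  @definable _ (sys_structure D hA) = D.
Proof.
move=> hD; apply/funext => X; apply/propext; split=> [|/(sys_rint_out hD) [r ->]].
  apply: definable_sub => // r s; exact: sys_rint_in.
by exists (@Rel (sys_language D) r (fun i => Var i)).
Qed.

Definition sys_expansion L (M : structure L) (D : eset M -> Prop) :
    structure (lang_sum L (sys_language D)) :=
  @Structure (lang_sum L (sys_language D)) M (dom_inh M)
    (fun f => match f return ('I_(@farity (lang_sum L (sys_language D)) f) -> M) -> M with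
              | inl h => @fint L M h | inr h => match h with end end)
    (fun r => match r return ('I_(@rarity (lang_sum L (sys_language D)) r) -> M) -> Prop with
              | inl q => @rint L M q | inr q => @sys_rint M D q end).

Lemma reduct_sys_expansion L (M : structure L) (D : eset M -> Prop) :
  reduct (sys_expansion D) = M.
Proof. by case: M D. Qed.

Lemma definable_sys_expansion (L : rel_language) (M : structure L)
    (D : eset M -> Prop) : defsys D -> (forall X, definable X -> D X) ->
  @definable _ (sys_expansion D) = D.
Proof.
move=> hD hM; apply/funext => X; apply/propext; split=> [|/(sys_rint_out hD) [r ->]].
  apply: definable_sub => //; first by case=> -[].
  case=> [q|q] s /=; last exact: sys_rint_in.
  by apply: hM; exists (@Rel L q (fun i => Var (s i))).
by exists (@Rel (lang_sum L (sys_language D)) (inr r) (fun i => Var i)).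
Qed.

(** Aritizability thus only asks for one suitable system above the definable sets of one model. *)
Lemma almost_naritizable_of_sys (L : rel_language) (T : theory L) (M : structure L)
    (D : eset M -> Prop) n :
  is_model M T -> 0 < n -> defsys D -> (forall X, definable X -> D X) ->
  almost_nary_sys D n -> almost_naritizable T n.
Proof.
move=> hM n0 hD sD h; exists (sys_language D), (Th (sys_expansion D)); split.
  move=> phi; rewrite (model_thmP _ hM) -[X in true_sentence X](reduct_sys_expansion D).
  exact: true_sentence_lift.
by apply/(almost_naryP (@is_model_Th _ _) n0); rewrite definable_sys_expansion.
Qed.

(** * Almost n-aritizability of disjoint unions *)

(** A model [N'] of the expansion still contains a part that models [T]; the traces on it of all
    sets definable in [N'] form the required system. *)
Lemma almost_naritizable_part (L K : rel_language) (P : psym K)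
    (g : psym L -> psym K) (hg : forall q, parity (g q) = parity q)
    (T : theory L) (A : structure L) (N : structure K) (f : A -> N) n :
  is_model A T -> is_part P hg f -> 0 < n ->
  almost_naritizable (Th N) n -> almost_naritizable T n.
Proof.
move=> hA hf n0 [E [T' [exp]]].
have [N' hN'] := thm_satisfiable T'.
move=> /(almost_naryP hN' n0) h.
have [A' [f' [hf' hA']]] := part_transfer hA hf (reduct_model exp hN').
apply: (@almost_naritizable_of_sys _ _ A' (trace f' (@definable _ N'))) => //.
- exact (trace_defsys (part_inj hf') (definable_defsys N')
    (definable_reduct (definable_part_dom hf'))).
- move=> X /(definable_part hf') [Y dY ->]; exists Y => //.
  exact: definable_reduct.
- exact: (almost_nary_trace (fun X => iff_refl _) h).
Qed.

Lemma almost_naritizable_dunion (L1 L2 : rel_language) (T1 : theory L1) (T2 : theory L2)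
    (M1 : structure L1) (M2 : structure L2) n :
  is_model M1 T1 -> is_model M2 T2 -> 0 < n ->
  almost_naritizable T1 n -> almost_naritizable T2 n ->
  almost_naritizable (Th (dunion M1 M2)) n.
Proof.
move=> hM1 hM2 n0 [E1 [T1' [exp1]]] + [E2 [T2' [exp2]]].
have [[N1 hN1] [N2 hN2]] := (thm_satisfiable T1', thm_satisfiable T2').
move=> /(almost_naryP hN1 n0) h1 /(almost_naryP hN2 n0) h2.
have [r1 r2] := (reduct_model exp1 hN1, reduct_model exp2 hN2).
have ds1 := definable_defsys N1; have ds2 := definable_defsys N2.
(* [S1] and [S2] have the definable sets of [N1] and [N2] but relational languages, so that [dunion]
   applies to them. *)
pose S1 := sys_structure (@definable _ N1) (dom_inh N1).
pose S2 := sys_structure (@definable _ N2) (dom_inh N2).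
pose D := @definable _ (dunion S1 S2).
have hD : defsys D := definable_defsys (dunion S1 S2).
apply: (@almost_naritizable_of_sys _ _ (dunion (reduct N1) (reduct N2)) D) => //.
- move=> phi; exact: (fun h => (dunion_transfer hM1 r1 hM2 r2 h).2).
(* Each symbol of the original union is definable in the new one: symbols of [L1] and [L2] name
   definable relations, hence symbols of the systems, and the predicates for the parts are the
   same. *)
- move=> X; apply: definable_sub => // -[[q|q]|b] s /=.
  + have [|H hH] := @sys_rint_rel _ (@definable _ N1) (dom_inh N1) _
        (@rint L1 (reduct N1) q).
      by apply: definable_reduct; exists (@Rel L1 q (fun i => Var i)).
    exists (@Rel (dunion_language (sys_language _) (sys_language _))
      (inl (inl (sys_symbol H))) (fun i => Var (s i))).
    by apply: eset_ext => e; split=> -[v hv /hH hq]; exists v.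
  + have [|H hH] := @sys_rint_rel _ (@definable _ N2) (dom_inh N2) _
        (@rint L2 (reduct N2) q).
      by apply: definable_reduct; exists (@Rel L2 q (fun i => Var i)).
    exists (@Rel (dunion_language (sys_language _) (sys_language _))
      (inl (inr (sys_symbol H))) (fun i => Var (s i))).
    by apply: eset_ext => e; split=> -[v hv /hH hq]; exists v.
  + exists (@Rel (dunion_language (sys_language _) (sys_language _)) (inr b)
      (fun=> Var (s ord0))).
    by case: b s.
- by apply: (@almost_nary_dunion _ _ S1 S2); rewrite ?definable_sys.
Qed.

Theorem theorem4p1 (L1 L2 : rel_language) (T1 : theory L1) (T2 : theory L2)
    (M1 : structure L1) (M2 : structure L2)
    (hM1 : is_model M1 T1) (hM2 : is_model M2 T2) :
  [/\ forall n : nat, 1 <= n ->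
        (almost_nary T1 n /\ almost_nary T2 n <->
         almost_nary (Th (dunion M1 M2)) n),
      aar (Th (dunion M1 M2)) = max_infty (aar T1) (aar T2)
    & forall n : nat, 1 <= n ->
        (almost_naritizable T1 n /\ almost_naritizable T2 n <->
         almost_naritizable (Th (dunion M1 M2)) n)].
Proof.
split=> [n n0||n n0]; first exact: almost_nary_dunionP.
  by apply: aar_conj => n n0; apply: almost_nary_dunionP.
split=> [[h1 h2]|h]; first exact: almost_naritizable_dunion h1 h2.
split; first exact: almost_naritizable_part hM1 (is_part_inl M1 M2) n0 h.
exact: almost_naritizable_part hM2 (is_part_inr M1 M2) n0 h.
Qed.
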